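(* In the setting and under the regularity assumption of the context, fix $x\in\mathcal X$ and write $\ell_k(z)=\ell_k(x,z)$, $\ell(z)=\ell(x,z)$. The worst-case expectation problem $\max_{\mathbb Q\in\mathcal P}\mathbb E_{z\sim\mathbb Q}[\ell(z)]$ is equivalent to the nonconvex program $$\max\left\{\frac1N\sum_{i=1}^N\sum_{k=1}^K\alpha_{ik}\ell_k(\hat z_i+v_{ik})\;:\;\begin{array}{l}\alpha_{ik}\in\mathbb R_+,\ v_{ik}\in\mathbb R^m,\ \hat z_i+v_{ik}\in\mathcal Z\ \ \forall i\in[N],\forall k\in[K],\\ \frac1N\sum_{i=1}^N\sum_{k=1}^K\alpha_{ik}c(\hat z_i+v_{ik},\hat z_i)\le\rho,\ \ \sum_{k=1}^K\alpha_{ik}=1\ \forall i\in[N]\end{array}\right\}.$$ Given an optimal solution $\{\alpha^\star_{ik},v^\star_{ik}\}$ of this program, the discrete distribution $\mathbb Q^\star:=\frac1N\sum_{i=1}^N\sum_{k=1}^K\alpha^\star_{ik}\delta_{\hat z_i+v^\star_{ik}}$ belongs to $\mathcal P$ and attains the maximum in the worst-case expectation problem. Furthermore, there exists an optimal solution in which at most $N+1$ of the weights $\{\alpha^\star_{ik}\}$ are nonzero. Consequently, there exists a worst-case distribution $\mathbb Q^\star$ supported on at most $N+1$ points.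
   Context: Notation: $[n]=\{1,\dots,n\}$; $\mathcal P(\mathcal Z)$ is the set of Borel probability measures on $\mathcal Z$. Setting. $\mathcal X\subseteq\mathbb R^n$, $\mathcal Z\subseteq\mathbb R^m$. A transportation cost $c:\mathcal Z\times\mathcal Z\to\mathbb R_+$ is lower semicontinuous, satisfies $c(z,z)=0$ for all $z$, and $c(\cdot,\hat z)$ is convex for every fixed $\hat z\in\mathcal Z$. The optimal transport discrepancy is $\mathrm{OT}_c(\mathbb P,\mathbb Q)=\min_{\gamma}\mathbb E_{(z,\hat z)\sim\gamma}[c(z,\hat z)]$ over couplings $\gamma$ of $\mathbb P$ and $\mathbb Q$. Given $\hat z_1,\dots,\hat z_N\in\mathcal Z$, let $\hat{\mathbb P}=\frac1N\sum_{i=1}^N\delta_{\hat z_i}$; given $\rho>0$, let $\mathcal P=\{\mathbb P\in\mathcal P(\mathcal Z):\mathrm{OT}_c(\mathbb P,\hat{\mathbb P})\le\rho\}$. Regularity assumption. (i) $\mathcal X$ is nonempty and convex; there exist $\mathbb Q_0\in\mathcal P$ and $x_0\in\mathcal X$ such that $x\mapsto\mathbb E_{z\sim\mathbb Q_0}[\ell(x,z)]$ is inf-compact on $\mathcal X$ (all sublevel sets are compact) and $\mathbb E_{z\sim\mathbb Q_0}[\ell(x_0,z)]>-\infty$; $\mathcal Z$ is nonempty, closed and convex. (ii) $\ell(x,z)=\max_{k\in[K]}\ell_k(x,z)$ with $K\ge2$, where each $\ell_k:\mathbb R^n\times\mathbb R^m\to\mathbb R$ is real-valued, convex in its first and concave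 in its second argument. (iii) There exist a norm $\|\cdot\|$ on $\mathbb R^m$ and $p\ge1$ with $c(z,\hat z)\ge\|z-\hat z\|^p$ for all $z,\hat z\in\mathcal Z$; moreover, if $p=1$, then for every $x\in\mathcal X$ there exist $g>0$, $\hat z_0\in\mathcal Z$ and $r\in[0,1)$ such that $\ell(x,z)\le g[1+\|z-\hat z_0\|^r]$ for all $z\in\mathcal Z$. *)

(* Defs.v *)
From HB Require Import structures.
From mathcomp Require Import all_boot all_order all_algebra.
From mathcomp Require Import all_classical all_reals all_analysis.

Set Implicit Arguments.
Unset Strict Implicit.
Unset Printing Implicit Defensive.

Import Order.TTheory GRing.Theory Num.Theory.
Import numFieldNormedType.Exports.

Local Open Scope classical_set_scope.
Local Open Scope ring_scope.

(* R^m with its Borel sigma-algebra; the carrier is convertible to 'rV[R]_m.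
   A Borel probability measure on a (closed) set Z of R^m is represented
   throughout by a probability Q on borel_rV R m with Q Z = 1. *)
Notation borel_rV R m := (g_sigma_algebraType (@open 'rV[R]_m)).

Definition is_norm (R : realType) (m : nat) (nrm : 'rV[R]_m -> R) : Prop :=
  [/\ forall u v, nrm (u + v) <= nrm u + nrm v,
      forall (a : R) u, nrm (a *: u) = `|a| * nrm u &
      forall u, nrm u = 0 -> u = 0].

(* The values of c outside Z x Z are irrelevant. *)
Definition transportation_cost (R : realType) (m : nat) (Z : set 'rV[R]_m)
    (c : 'rV[R]_m -> 'rV[R]_m -> R) : Prop :=
  [/\ forall z zh, Z z -> Z zh -> 0 <= c z zh,
      lower_semicontinuous (fun w : subspace (Z `*` Z) =>
        (c (w : 'rV[R]_m * 'rV[R]_m).1 (w : 'rV[R]_m * 'rV[R]_m).2)%:E),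
      forall z, Z z -> c z z = 0 &
      forall zh, Z zh -> convex_function Z (fun z => c z zh)].

Section OptimalTransport.
Variables (R : realType) (m : nat).
Local Notation T := (borel_rV R m).
Implicit Types (P Q : set T -> \bar R) (Z : set 'rV[R]_m)
  (c : 'rV[R]_m -> 'rV[R]_m -> R).

Definition discrete_distribution (I : finType) (w : I -> R)
    (a : I -> 'rV[R]_m) : set T -> \bar R :=
  fun A => (\sum_(i : I) (w i)%:E * \d_(a i : T) A)%E.

Definition empirical (N : nat) (zhat : 'I_N -> 'rV[R]_m) : set T -> \bar R :=
  discrete_distribution (fun=> N%:R^-1) zhat.

Definition coupling P Q (gamma : probability (T * T)%type R) : Prop :=
  forall A : set T, measurable A ->
    gamma (A `*` setT) = P A /\ gamma (setT `*` A) = Q A.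

(* The minimum over couplings, as an infimum (it is attained because c is
   nonnegative and lower semicontinuous). *)
Definition OT Z c P Q : \bar R :=
  ereal_inf [set (\int[gamma]_(w in Z `*` Z) (c w.1 w.2)%:E)%E |
             gamma in coupling P Q].

Definition ambiguity_set Z c (N : nat) (zhat : 'I_N -> 'rV[R]_m) (rho : R) :
    set (probability T R) :=
  [set Q | Q Z = 1%E /\ (OT Z c Q (empirical zhat) <= rho%:E)%E].

(* max_k f k; it is a real number as soon as 0 < K. *)
Definition max_of (K : nat) (f : 'I_K -> R) : \bar R :=
  (\big[Order.max/-oo]_(k < K) (f k)%:E)%E.

(* The positive part of the losses of interest is integrable for every measure
   of the ambiguity set, so the integral is an unambiguous element of
   [-oo, +oo[. *)
Definition expected_loss Z (f : 'rV[R]_m -> \bar R) (Q : probability T R) :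
    \bar R :=
  (\int[Q]_(z in Z) f z)%E.

Definition worst_case_distribution Z c (N : nat) (zhat : 'I_N -> 'rV[R]_m)
    (rho : R) (f : 'rV[R]_m -> \bar R) (Q : probability T R) : Prop :=
  ambiguity_set Z c zhat rho Q /\
  forall Q' : probability T R, ambiguity_set Z c zhat rho Q' ->
    (expected_loss Z f Q' <= expected_loss Z f Q)%E.

End OptimalTransport.

Section NonconvexProgram.
Variables (R : realType) (m N K : nat).
Variables (Z : set 'rV[R]_m) (c : 'rV[R]_m -> 'rV[R]_m -> R).
Variables (zhat : 'I_N -> 'rV[R]_m) (rho : R) (l : 'I_K -> 'rV[R]_m -> R).
Implicit Types (alpha : 'I_N -> 'I_K -> R) (v : 'I_N -> 'I_K -> 'rV[R]_m).

Definition feasible alpha v : Prop :=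
  [/\ forall i k, 0 <= alpha i k,
      forall i k, Z (zhat i + v i k),
      N%:R^-1 * (\sum_(i < N) \sum_(k < K)
        alpha i k * c (zhat i + v i k) (zhat i)) <= rho &
      forall i, \sum_(k < K) alpha i k = 1].

Definition objective alpha v : R :=
  N%:R^-1 * (\sum_(i < N) \sum_(k < K) alpha i k * l k (zhat i + v i k)).

Definition optimal alpha v : Prop :=
  feasible alpha v /\
  forall alpha' v', feasible alpha' v' ->
    objective alpha' v' <= objective alpha v.

Definition program_distribution alpha v : set (borel_rV R m) -> \bar R :=
  discrete_distribution
    (fun ik : 'I_N * 'I_K => N%:R^-1 * alpha ik.1 ik.2)
    (fun ik : 'I_N * 'I_K => zhat ik.1 + v ik.1 ik.2).

End NonconvexProgram.

(* Main.v *)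
(* The worst-case expectation and the optimal value of the program are compared
   by Lagrangian duality. Merging atoms with the same pair (i, k) shows that the
   optimal value V(s) of the program is concave in the budget s; as rho > 0, it
   has a supergradient lambda >= 0 at rho.
   Testing the supergradient inequality on one atom per i gives
     lambda rho + 1/N sum_i S_i <= V(rho),
   where S_i = sup_(k, z) (l_k z - lambda c(z, zhat_i)). Integrating
   l z <= lambda c(z, zhat_i) + S_i against a nearly optimal coupling then
   bounds E_Q[l] by V(rho) for each Q of the ambiguity set: neither Jensen's
   inequality nor an optimal coupling is needed.
   The program has an optimal solution: along a maximizing sequence, an atom
   that escapes to infinity has vanishing weight and, as l grows more slowly
   than c, contributes nothing in the limit. A sparse solution is obtained by
   moving alpha in the kernel of the N + 1 linear constraints until one more
   weight vanishes. *)

Require Import Defs.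
From HB Require Import structures.
From mathcomp Require Import all_boot all_order all_algebra.
From mathcomp Require Import all_classical all_reals all_analysis.
From mathcomp Require Import measurable_realfun ring lra.

Set Implicit Arguments.
Unset Strict Implicit.
Unset Printing Implicit Defensive.

Import Order.TTheory GRing.Theory Num.Theory.
Import numFieldNormedType.Exports.

Local Open Scope classical_set_scope.
Local Open Scope ring_scope.

(** * Convex functions and norms on R^m *)

Section ConvexFunctions.
Variables (R : realType) (m : nat).
Implicit Types (D : set 'rV[R]_m) (g : 'rV[R]_m -> R).

Lemma convex_functionE D g (x y : 'rV[R]_m) (a b : R) :
  convex_function D g -> D x -> D y -> 0 <= a -> 0 <= b -> a + b = 1 ->
  g (a *: x + b *: y) <= a * g x + b * g y.
Proof.
move=> gcvx Dx Dy a0 b0 ab.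
have a01 : 0 <= a <= 1 by rewrite a0 -ab lerDl.
have bE : b = 1 - a by rewrite -ab addrAC subrr add0r.
have /(_ (mem_set Dx) (mem_set Dy)) :=
  gcvx (@Itv01 R a (proj1 (andP a01)) (proj2 (andP a01))) x y.
by rewrite bE.
Qed.

Lemma convex_setE D (x y : 'rV[R]_m) (a b : R) :
  convex_set D -> D x -> D y -> 0 <= a -> 0 <= b -> a + b = 1 ->
  D (a *: x + b *: y).
Proof.
move=> Dcvx Dx Dy a0 b0 ab.
have a01 : 0 <= a <= 1 by rewrite a0 -ab lerDl.
have bE : b = 1 - a by rewrite -ab addrAC subrr add0r.
have := Dcvx x y (@Itv01 R a (proj1 (andP a01)) (proj2 (andP a01)))
  (mem_set Dx) (mem_set Dy).
by rewrite bE inE.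
Qed.

Lemma convex_bounded_box g (y : 'rV[R]_m) (s : seq 'I_m) :
  convex_function setT g ->
  exists M, forall u : 'rV[R]_m, (forall j, `|u 0 j| <= 1) ->
    g (y + \sum_(j <- s) u 0 j *: delta_mx 0 j) <= M.
Proof.
move=> gcvx; elim: s y => [|j s IH] y.
  by exists (g y) => u _; rewrite big_nil addr0.
have [M1 hM1] := IH (y + delta_mx 0 j).
have [M2 hM2] := IH (y - delta_mx 0 j).
exists (Num.max M1 M2) => u hu; rewrite big_cons.
set S := \sum_(_ <- s) _.
pose a := (1 + u 0 j) / 2; pose b := (1 - u 0 j) / 2.
have := hu j; rewrite ler_norml => /andP[hu1 hu2].
have a0 : 0 <= a by rewrite divr_ge0//; lra.
have b0 : 0 <= b by rewrite divr_ge0//; lra.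
have ab : a + b = 1 by rewrite /a /b; lra.
have -> : y + (u 0 j *: delta_mx 0 j + S) =
    a *: (y + delta_mx 0 j + S) + b *: (y - delta_mx 0 j + S).
  have -> : u 0 j = a - b by rewrite /a /b; lra.
  have -> : y + ((a - b) *: delta_mx 0 j + S) =
    (a + b) *: y + ((a - b) *: delta_mx 0 j + (a + b) *: S) by rewrite ab !scale1r.
  move: (delta_mx 0 j) => d; apply/rowP => i; rewrite !mxE; ring.
apply: (le_trans (convex_functionE gcvx I I a0 b0 ab)).
have := ler_wpM2l a0 (hM1 u hu); have := ler_wpM2l b0 (hM2 u hu).
rewrite -/S => h2 h1; apply: (le_trans (lerD h1 h2)).
rewrite -[leRHS]mul1r -ab mulrDl lerD ?ler_wpM2l// le_max lexx ?orbT//.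
Qed.

Lemma mx_norm_coord (u : 'rV[R]_m) j : `|u 0 j| <= `|u|.
Proof.
by rewrite [leRHS]/Num.norm /= mx_normrE; apply/bigmax_geP; right => /=; exists (0, j).
Qed.

Lemma convex_bounded_ball g (y : 'rV[R]_m) :
  convex_function setT g -> exists M, forall u, `|u| <= 1 -> g (y + u) <= M.
Proof.
move=> gcvx; have [M hM] := convex_bounded_box y (index_enum 'I_m) gcvx.
exists M => u hu; rewrite [u]row_sum_delta; apply: hM => j.
exact: le_trans (mx_norm_coord u j) hu.
Qed.

(* Compare [g (y + h)] with [g] at the points of the segments joining
   [y - h/|h|] to [y + h], and [y] to [y + h/|h|]. *)
Lemma convex_local_lipschitz g (y : 'rV[R]_m) : convex_function setT g ->
  exists B, [/\ 0 <= B, forall h, g y - B * `|h| <= g (y + h) &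
                forall h, `|h| <= 1 -> g (y + h) <= g y + B * `|h|].
Proof.
move=> gcvx; have [M hM] := convex_bounded_ball y gcvx.
have gM : g y <= M by rewrite -[y]addr0 hM// normr0.
exists (M - g y); split; first by rewrite subr_ge0.
- move=> h; have [->|h0] := eqVneq h 0; first by rewrite normr0 mulr0 subr0 addr0.
  set n := `|h|; have n0 : 0 < n by rewrite normr_gt0.
  have n1 : 0 < 1 + n by lra.
  have e : y = (n / (1 + n)) *: (y - n^-1 *: h) + (1 / (1 + n)) *: (y + h).
    apply/rowP => i; rewrite !mxE; field; rewrite !gt_eqF//.
  have hb : g (y - n^-1 *: h) <= M.
    by apply: hM; rewrite normrN normrZ ger0_norm ?invr_ge0 ?(ltW n0)// mulVf ?gt_eqF.
  have : g y <= (n / (1 + n)) * g (y - n^-1 *: h) + (1 / (1 + n)) * g (y + h).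
    rewrite {1}e; apply: convex_functionE => //; first by rewrite divr_ge0 ?ltW.
      by rewrite divr_ge0 ?ltW.
    by field; rewrite gt_eqF.
  rewrite -[X in _ <= X](_ : (n * g (y - n^-1 *: h) + g (y + h)) / (1 + n) = _); last first.
    by field; rewrite gt_eqF.
  rewrite ler_pdivlMr// => hh.
  have := ler_wpM2l (ltW n0) hb; lra.
- move=> h h1; have [->|h0] := eqVneq h 0; first by rewrite normr0 mulr0 !addr0.
  set n := `|h|; have n0 : 0 < n by rewrite normr_gt0.
  have e : y + h = (1 - n) *: y + n *: (y + n^-1 *: h).
    by apply/rowP => i; rewrite !mxE; field; rewrite gt_eqF.
  have hb : g (y + n^-1 *: h) <= M.
    by apply: hM; rewrite normrZ ger0_norm ?invr_ge0 ?(ltW n0)// mulVf ?gt_eqF.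
  have : g (y + h) <= (1 - n) * g y + n * g (y + n^-1 *: h).
    rewrite {1}e; apply: convex_functionE => //; rewrite ?(ltW n0)//; last by rewrite subrK.
    by rewrite subr_ge0.
  have := ler_wpM2l (ltW n0) hb; lra.
Qed.

Lemma convex_continuous g : convex_function setT g -> continuous g.
Proof.
move=> gcvx y; have [B [B0 hl hu]] := convex_local_lipschitz y gcvx.
apply: (@cvgrPdist_le _ _ _ (nbhs y) _ g (g y)).2 => e e0.
have B1 : 0 < B + 1 by lra.
near=> z.
have yz : `|z - y| <= e / (B + 1).
  by rewrite distrC; near: z; apply: cvgr_dist_le => //; rewrite divr_gt0.
have yz1 : `|z - y| <= 1.
  by rewrite distrC; near: z; apply: cvgr_dist_le.
have := hl (z - y); have := hu _ yz1; rewrite [y + _]addrC subrK => h1 h2.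
have h3 : B * `|z - y| <= e.
  rewrite ler_pdivlMr// in yz; apply: le_trans yz.
  have := normr_ge0 (z - y); nra.
rewrite ler_norml; apply/andP; split; lra.
Unshelve. all: by end_near. Qed.

Lemma is_norm_ge0 (nrm : 'rV[R]_m -> R) u : is_norm nrm -> 0 <= nrm u.
Proof.
case=> tri hom _.
have n0 : nrm 0 = 0 by rewrite -(scale0r u) hom normr0 mul0r.
have := tri u (-1 *: u); rewrite hom normrN1 mul1r scaleN1r subrr n0; lra.
Qed.

Lemma norm_le_is_norm (nrm : 'rV[R]_m -> R) : is_norm nrm ->
  exists2 C, 0 < C & forall u, `|u| <= C * nrm u.
Proof.
move=> nn; have [tri hom sep] := nn.
have ncvx : convex_function setT nrm.
  move=> t x y _ _; apply: (le_trans (tri _ _)).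
  rewrite !hom !ger0_norm ?onem_ge0 ?le1 ?ge0//.
  by rewrite unstable.onem_ge0// le1.
have ncont := convex_continuous ncvx.
pose S := [set u : 'rV[R]_m | `|u| = 1].
have Scpt : compact S.
  apply: bounded_closed_compact.
    by exists 1; split => // M M1 u /= ->; exact: ltW.
  have -> : S = (fun u : 'rV[R]_m => `|u|) @^-1` [set 1] by [].
  by apply: preimage_closed => [u _|]; [exact: norm_continuous|exact: closed_eq].
have [S0|/set0P S0] := eqVneq S set0.
  exists 1 => // u; rewrite mul1r.
  have [->|u0] := eqVneq u 0; first by rewrite normr0 is_norm_ge0.
  suff : S (`|u|^-1 *: u) by rewrite S0.
  by rewrite /S/= normrZ ger0_norm ?invr_ge0// mulVf ?normr_eq0.
have [u0 Su0 hmin] : exists2 u0, S u0 & forall u, S u -> nrm u0 <= nrm u.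
  have [|u0 /set_mem ? h] := @compact_EVT_min _ _ nrm S S0 Scpt.
    exact: continuous_subspaceT.
  by exists u0 => // u /mem_set; exact: h.
have n0 : 0 < nrm u0.
  rewrite lt_neqAle is_norm_ge0// andbT eq_sym; apply/eqP => /sep u00.
  by move: Su0; rewrite /S/= u00 normr0 => /eqP; rewrite eq_sym oner_eq0.
exists (nrm u0)^-1; first by rewrite invr_gt0.
move=> u; have [->|u1] := eqVneq u 0.
  by rewrite normr0 mulr_ge0 ?is_norm_ge0 ?invr_ge0 ?is_norm_ge0.
have nu : 0 < `|u| by rewrite normr_gt0.
have := hmin (`|u|^-1 *: u).
rewrite /S/= normrZ hom !ger0_norm ?invr_ge0// mulVf ?normr_eq0// => /(_ erefl).
rewrite [leRHS]mulrC ler_pdivlMr// => h.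
by rewrite [leRHS]mulrC ler_pdivlMr// mulrC.
Qed.

End ConvexFunctions.

(** * Borel measurability and discrete probabilities *)

Section BorelRV.
Variables (R : realType) (m : nat).
Local Notation T := (borel_rV R m).

Lemma open_measurable_rV (A : set 'rV[R]_m) : open A -> measurable (A : set T).
Proof. by move=> oA; apply: sub_sigma_algebra. Qed.

Lemma closed_measurable_rV (A : set 'rV[R]_m) :
  closed A -> measurable (A : set T).
Proof.
move=> cA; rewrite -[A]setCK; apply: measurableC.
by apply: open_measurable_rV; exact: closed_openC.
Qed.

Lemma measurable_set1_rV (x : 'rV[R]_m) : measurable ([set x] : set T).
Proof.
apply: closed_measurable_rV; apply: accessible_closed_set1.
by apply: hausdorff_accessible; exact: norm_hausdorff.
Qed.

Lemma continuous_measurable_rV (f : 'rV[R]_m -> R) :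
  continuous f -> measurable_fun setT (f : T -> R).
Proof.
move=> /continuousP cf; apply: (measurability _ (RGenOpens.measurableE R)).
move=> _ [_ [a [b ->] <-]]; rewrite setTI; apply: open_measurable_rV.
exact/cf/interval_open.
Qed.

Definition rat_box (a b : 'rV[rat]_m) : set 'rV[R]_m :=
  [set x | forall j, ratr (a 0 j) < x 0 j < ratr (b 0 j)].

Lemma measurable_rat_box a b : measurable (rat_box a b : set T).
Proof.
have -> : rat_box a b = \bigcap_(j in [set: 'I_m])
    ((fun x : 'rV[R]_m => x 0 j) @^-1` `]ratr (a 0 j), ratr (b 0 j)[%classic).
  apply/seteqP; split => x /= h j; first by move=> _; rewrite /= in_itv/=.
  by have := h j I; rewrite /= in_itv.
apply: fin_bigcap_measurable => // j _; apply: open_measurable_rV.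
apply: open_comp => [x _|]; first exact: coord_continuous.
exact: interval_open.
Qed.

Lemma nbhs_rat_box (x : 'rV[R]_m) (A : set 'rV[R]_m) : nbhs x A ->
  exists a b, rat_box a b x /\ rat_box a b `<=` A.
Proof.
move=> /nbhs_ballP[e /= e0 eA].
have /choice[a ha] : forall j : 'I_m, exists q : rat, x 0 j - e < ratr q < x 0 j.
  move=> j; have : x 0 j - e < x 0 j by rewrite ltrBlDr ltrDl.
  by move/rat_in_itvoo => [q]; rewrite in_itv/= => hq; exists q.
have /choice[b hb] : forall j : 'I_m, exists q : rat, x 0 j < ratr q < x 0 j + e.
  move=> j; have : x 0 j < x 0 j + e by rewrite ltrDl.
  by move/rat_in_itvoo => [q]; rewrite in_itv/= => hq; exists q.
exists (\row_j a j), (\row_j b j); split.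
  move=> j; rewrite !mxE; have /andP[_ ->] := ha j.
  by have /andP[-> _] := hb j.
move=> y hy; apply: eA; split => // i j; rewrite /ball/= ord1.
have := hy j; rewrite !mxE => /andP[h1 h2].
have /andP[h3 h4] := ha j; have /andP[h5 h6] := hb j.
by rewrite ltr_norml; apply/andP; split; lra.
Qed.

Lemma open_prod_measurable (O : set ('rV[R]_m * 'rV[R]_m)) :
  open O -> measurable (O : set (T * T)%type).
Proof.
move=> oO.
pose I := ('rV[rat]_m * 'rV[rat]_m * ('rV[rat]_m * 'rV[rat]_m))%type.
pose B (i : I) := rat_box i.1.1 i.1.2 `*` rat_box i.2.1 i.2.2.
have -> : O = \bigcup_(i in [set: I]) (if `[< B i `<=` O >] then B i else set0).
  apply/seteqP; split => [[x y] Oxy|w [i _]]; last by case: asboolP => // + Bw; apply.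
  have [[U V] /= [xU yV] UV] : nbhs (x, y) O by exact: open_nbhs_nbhs.
  have [a [b [abx abU]]] := nbhs_rat_box xU.
  have [c [d [cdy cdV]]] := nbhs_rat_box yV.
  exists ((a, b), (c, d)) => //; case: asboolP => [_|[]] //=.
  by move=> w [/abU ? /cdV ?]; apply: UV.
apply: countable_bigcupT_measurable; first exact: countableP.
move=> i; case: asboolP => // _.
by apply: measurableX; exact: measurable_rat_box.
Qed.

Lemma lower_semicontinuous_measurable_rV (D : set ('rV[R]_m * 'rV[R]_m))
    (f : 'rV[R]_m * 'rV[R]_m -> \bar R) :
  measurable (D : set (T * T)%type) ->
  lower_semicontinuous (f : subspace D -> \bar R) ->
  measurable_fun (D : set (T * T)%type) f.
Proof.
move=> mD lf; apply: (measurability _ (ErealGenOInfty.measurableE R)).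
move=> /= _ [_ [a ->]] <-; rewrite preimage_itvoy.
have /(_ a) lfa := (lower_semicontinuousP _).1 lf.
have [V oV VD] := (open_subspaceP _ _).1 lfa.
rewrite setIC -VD; apply: measurableI => //; exact: open_prod_measurable.
Qed.

End BorelRV.

Section DiscreteProbability.
Context d (T : measurableType d) (R : realType) (I : finType).
Variables (w : I -> R) (a : I -> T).
Hypotheses (w0 : forall i, 0 <= w i) (w1 : \sum_i w i = 1).
Local Open Scope ereal_scope.

Lemma discrete_probability_exists : exists Q : probability T R,
  (forall A, measurable A -> Q A = \sum_i (w i)%:E * \d_(a i) A) /\
  forall (D : set T) (f : T -> R), measurable D -> (forall i, D (a i)) ->
    measurable_fun D f ->
    \int[Q]_(x in D) (f x)%:E = (\sum_i w i * f (a i))%:E.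
Proof.
have [i0|I0] := pickP (@predT I); last first.
  by move: w1; rewrite big_pred0// => /eqP; rewrite eq_sym oner_eq0.
move=> _.
pose e (n : nat) := nth i0 (enum I) n.
pose mu_ (n : nat) : {measure set T -> \bar R} :=
  mscale (NngNum (w0 (e n))) (\d_(a (e n)) : {measure set T -> \bar R}).
pose mu : {measure set T -> \bar R} := msum mu_ #|I|.
have reindexI (F : I -> \bar R) : \sum_(n < #|I|) F (e n) = \sum_i F i.
  rewrite [RHS](reindex (fun n : 'I_#|I| => enum_val n))/=; last first.
    exact/onW_bij/enum_val_bij.
  by apply: eq_bigr => n _; rewrite /e (enum_val_nth i0).
have muE A : mu A = \sum_i (w i)%:E * \d_(a i) A.
  by rewrite /mu/= /msum/= -(reindexI (fun i => (w i)%:E * \d_(a i) A)).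
have mu1 : mu setT = 1.
  rewrite muE; under eq_bigr do rewrite diracT mule1.
  by rewrite sumEFin w1.
pose Q : probability T R := HB.pack (msum mu_ #|I|)
  (Measure_isProbability.Build _ _ _ (msum mu_ #|I|) mu1).
have QE A : Q A = mu A by [].
have ge0Q (D : set T) (f : T -> \bar R) : measurable D -> (forall i, D (a i)) ->
    measurable_fun D f -> (forall x, D x -> 0 <= f x) ->
    \int[Q]_(x in D) f x = \sum_i (w i)%:E * f (a i).
  move=> mD Da mf f0.
  rewrite (@eq_measure_integral _ _ _ _ mu)//.
  rewrite ge0_integral_measure_sum//.
  rewrite -(reindexI (fun i => (w i)%:E * f (a i))); apply: eq_bigr => n _.
  by rewrite ge0_integral_mscale// integral_dirac// diracE mem_set// mul1e.
exists Q; split => [A _|D f mD Da mf]; first by rewrite QE muE.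
rewrite integralE !ge0Q//;
  [|exact/measurable_funeneg/measurable_EFinP
   |exact/measurable_funepos/measurable_EFinP].
under eq_bigr do rewrite funeposE -EFin_max -EFinM.
under [X in _ - X]eq_bigr do rewrite funenegE -EFinN -EFin_max -EFinM.
rewrite !sumEFin -EFinB -sumrB; congr EFin; apply: eq_bigr => i _.
rewrite -mulrBr; congr (_ * _)%R; rewrite /Order.max; case: ltP => ?; case: ltP => ?; lra.

Qed.

End DiscreteProbability.

Section Marginals.
Local Open Scope ereal_scope.

Lemma integral_marginal (R : realType) d1 d2
    (X : measurableType d1) (Y : measurableType d2)
    (gamma : probability X R) (Q : probability Y R) (phi : X -> Y)
    (D : set X) (E : set Y) (g : Y -> \bar R) :
    measurable_fun setT phi -> measurable D -> measurable E ->
    D `<=` phi @^-1` E -> gamma D = 1 ->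
    (forall A, measurable A -> gamma (phi @^-1` A) = Q A) ->
    measurable_fun E g ->
  \int[Q]_(y in E) g y = \int[gamma]_(x in D) g (phi x).
Proof.
move=> mphi mD mE DE gD gQ mg.
have mpE : measurable (phi @^-1` E) by rewrite -[_ @^-1` _]setTI; exact: mphi.
suff ge0 (h : Y -> \bar R) : measurable_fun E h -> (forall y, 0 <= h y) ->
    \int[Q]_(y in E) h y = \int[gamma]_(x in D) h (phi x).
  rewrite integralE [RHS]integralE !ge0//.
- by congr (_ - _); apply: eq_integral => x _; rewrite !(funeposE, funenegE).
- exact: measurable_funeneg.
- exact: measurable_funepos.
move=> mh h0.
rewrite -(@eq_measure_integral _ _ _ _ _ (pushforward gamma phi)); last first.
  by move=> A mA _; exact: gQ.
rewrite ge0_integral_pushforward//.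
have gDC : gamma (~` D) = 0 by rewrite probability_setC// gD subee.
have mhphi : measurable_fun (phi @^-1` E) (h \o phi).
  by apply: (measurable_comp mE _ mh); [move=> _ [x ? <-]|exact: measurable_funTS].
rewrite (ge0_negligible_integral (measurableC mD) mpE mhphi (fun x _ => h0 _) gDC).
by rewrite setDE setCK setIidr.
Qed.

End Marginals.

(** * Duality for the finite program *)

Lemma supergradient (R : realType) (P : R -> R -> Prop) (rho V s0 t0 : R) :
    (forall s1 t1 s2 t2 a b, P s1 t1 -> P s2 t2 -> 0 <= a -> 0 <= b ->
      a + b = 1 -> exists2 t, a * t1 + b * t2 <= t & P (a * s1 + b * s2) t) ->
    (forall s s' t, s <= s' -> P s t -> P s' t) ->
    s0 < rho -> P s0 t0 -> P rho V -> (forall t, P rho t -> t <= V) ->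
  exists2 lambda, 0 <= lambda & forall s t, P s t -> t <= V + lambda * (s - rho).
Proof.
move=> Pccv Pmono s0rho P0 PV Vmax.
have slope s1 t1 s2 t2 : P s1 t1 -> P s2 t2 -> s1 < rho -> rho < s2 ->
    (t2 - V) / (s2 - rho) <= (V - t1) / (rho - s1).
  move=> P1 P2 s1r rs2.
  have s12 : 0 < s2 - s1 by lra.
  have [|||t ht Pt] := Pccv _ _ _ _ ((s2 - rho) / (s2 - s1)) ((rho - s1) / (s2 - s1)) P1 P2.
  - by rewrite divr_ge0//; lra.
  - by rewrite divr_ge0//; lra.
  - by field; rewrite gt_eqF.
  move: Pt.
  have -> : (s2 - rho) / (s2 - s1) * s1 + (rho - s1) / (s2 - s1) * s2 = rho.
    by field; rewrite gt_eqF.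
  move/Vmax => tV.
  have := le_trans ht tV.
  rewrite mulrAC [X in _ + X]mulrAC -mulrDl ler_pdivrMr// => h.
  by rewrite ler_pdivrMr ?subr_gt0// mulrAC ler_pdivlMr ?subr_gt0//; lra.
pose E := [set q | exists s t, [/\ P s t, rho < s & q = (t - V) / (s - rho)]].
have E0 : E 0.
  exists (rho + 1), V; rewrite subrr mul0r ltrDl; split => //.
  by apply: Pmono PV; rewrite lerDl.
have Eub s1 t1 : P s1 t1 -> s1 < rho -> ubound E ((V - t1) / (rho - s1)).
  by move=> P1 s1r _ [s [t [Pst rs ->]]]; exact: slope.
have supE : has_sup E by split; [exists 0|eexists; exact: Eub P0 s0rho].
exists (sup E).
  by apply: ub_le_sup => //; exact: supE.2.
move=> s t Pst; have [sr|rs|sr] := ltgtP s rho.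
- have : sup E <= (V - t) / (rho - s) by apply: ge_sup; [exists 0|exact: Eub].
  by rewrite ler_pdivlMr ?subr_gt0//; lra.
- have : (t - V) / (s - rho) <= sup E.
    by apply: ub_le_sup; [exact: supE.2|exists s, t].
  by rewrite ler_pdivrMr ?subr_gt0//; lra.
- by rewrite sr subrr mulr0 addr0; apply: Vmax; rewrite -sr.
Qed.

Section Program.
Variables (R : realType) (m N K : nat).
Variables (Z : set 'rV[R]_m) (c : 'rV[R]_m -> 'rV[R]_m -> R).
Variables (zhat : 'I_N -> 'rV[R]_m) (l : 'I_K -> 'rV[R]_m -> R).
Hypotheses (N0 : (0 < N)%N) (Zzhat : forall i, Z (zhat i)).
Hypothesis c_refl : forall z, Z z -> c z z = 0.
Hypothesis c_cvx : forall zh, Z zh -> convex_function Z (c^~ zh).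
Hypothesis Zcvx : convex_set Z.
Hypothesis l_ccv : forall k, convex_function setT (fun z => - l k z).

Local Notation feasible := (@feasible R m N K Z c zhat).
Local Notation objective := (objective zhat l).

Lemma feasible_mono s s' alpha v :
  s <= s' -> feasible s alpha v -> feasible s' alpha v.
Proof. by move=> ss' [? ? h ?]; split => //; exact: le_trans h ss'. Qed.

Lemma merge_atoms i k (a1 a2 : R) (z1 z2 : 'rV[R]_m) :
  0 <= a1 -> 0 <= a2 -> Z z1 -> Z z2 -> exists z, [/\ Z z,
    (a1 + a2) * c z (zhat i) <= a1 * c z1 (zhat i) + a2 * c z2 (zhat i) &
    a1 * l k z1 + a2 * l k z2 <= (a1 + a2) * l k z].
Proof.
move=> a10 a20 Zz1 Zz2.
have [a0|a0] := eqVneq (a1 + a2) 0.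
  have /andP[/eqP -> /eqP ->] : (a1 == 0) && (a2 == 0) by rewrite -paddr_eq0// a0.
  by exists z1; rewrite addr0 !mul0r addr0.
have apos : 0 < a1 + a2 by rewrite lt_neqAle eq_sym a0 addr_ge0.
pose t1 := a1 / (a1 + a2); pose t2 := a2 / (a1 + a2).
have t10 : 0 <= t1 by rewrite divr_ge0// ltW.
have t20 : 0 <= t2 by rewrite divr_ge0// ltW.
have t12 : t1 + t2 = 1 by rewrite /t1 /t2 -mulrDl divff.
have e1 x : a1 * x = (a1 + a2) * (t1 * x) by rewrite mulrA /t1 mulrCA divff// mulr1.
have e2 x : a2 * x = (a1 + a2) * (t2 * x) by rewrite mulrA /t2 mulrCA divff// mulr1.
exists (t1 *: z1 + t2 *: z2); split; first exact: convex_setE.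
- rewrite e1 e2 -mulrDr ler_pM2l//.
  exact: (convex_functionE (c_cvx (Zzhat i))).
- rewrite e1 e2 -mulrDr ler_pM2l//.
  have := convex_functionE (l_ccv k) (I : setT z1) (I : setT z2) t10 t20 t12.
  by rewrite !mulrN -opprD lerN2.
Qed.

Lemma program_concave s1 s2 al1 v1 al2 v2 (a b : R) :
  feasible s1 al1 v1 -> feasible s2 al2 v2 -> 0 <= a -> 0 <= b -> a + b = 1 ->
  exists alpha v, feasible (a * s1 + b * s2) alpha v /\
    a * objective al1 v1 + b * objective al2 v2 <= objective alpha v.
Proof.
move=> [al10 Zv1 cost1 sum1] [al20 Zv2 cost2 sum2] a0 b0 ab.
have /choice[z hz] : forall ik : 'I_N * 'I_K, exists z, [/\ Z z,
    (a * al1 ik.1 ik.2 + b * al2 ik.1 ik.2) * c z (zhat ik.1) <=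
    a * al1 ik.1 ik.2 * c (zhat ik.1 + v1 ik.1 ik.2) (zhat ik.1) +
    b * al2 ik.1 ik.2 * c (zhat ik.1 + v2 ik.1 ik.2) (zhat ik.1) &
    a * al1 ik.1 ik.2 * l ik.2 (zhat ik.1 + v1 ik.1 ik.2) +
    b * al2 ik.1 ik.2 * l ik.2 (zhat ik.1 + v2 ik.1 ik.2) <=
    (a * al1 ik.1 ik.2 + b * al2 ik.1 ik.2) * l ik.2 z].
  by move=> [i k] /=; apply: merge_atoms; rewrite ?mulr_ge0.
exists (fun i k => a * al1 i k + b * al2 i k), (fun i k => z (i, k) - zhat i).
have zE i k : zhat i + (z (i, k) - zhat i) = z (i, k) by rewrite addrC subrK.
have sumE (F1 F2 : 'I_N -> 'I_K -> R) :
    a * (N%:R^-1 * \sum_i \sum_k al1 i k * F1 i k) +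
    b * (N%:R^-1 * \sum_i \sum_k al2 i k * F2 i k) =
    N%:R^-1 * \sum_i \sum_k (a * al1 i k * F1 i k + b * al2 i k * F2 i k).
  rewrite mulrCA [X in _ + X]mulrCA -mulrDr; congr (_ * _).
  rewrite !mulr_sumr -big_split; apply: eq_bigr => i _ /=.
  rewrite !mulr_sumr -big_split; apply: eq_bigr => k _ /=.
  by rewrite !mulrA.
split; first split.
- by move=> i k; rewrite addr_ge0 ?mulr_ge0.
- by move=> i k; rewrite zE; have [] := hz (i, k).
- apply: le_trans (lerD (ler_wpM2l a0 cost1) (ler_wpM2l b0 cost2)).
  rewrite sumE ler_wpM2l ?invr_ge0//.
  apply: ler_sum => i _; apply: ler_sum => k _.
  by rewrite zE; have [] := hz (i, k).
- by move=> i; rewrite big_split -!mulr_sumr/= sum1 sum2 !mulr1.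
rewrite sumE ler_wpM2l ?invr_ge0//.
apply: ler_sum => i _; apply: ler_sum => k _.
by rewrite zE; have [] := hz (i, k).
Qed.

Lemma sum_indic (k0 : 'I_K) (F : 'I_K -> R) :
  \sum_k (k == k0)%:R * F k = F k0.
Proof.
rewrite (bigD1 k0)//= eqxx mul1r big1 ?addr0// => k /negPf ->.
by rewrite mul0r.
Qed.

Lemma feasible_choice (kappa : 'I_N -> 'I_K) (z : 'I_N -> 'rV[R]_m) :
  (forall i, Z (z i)) ->
  feasible (N%:R^-1 * \sum_i c (z i) (zhat i))
    (fun i k => (k == kappa i)%:R) (fun i k => z i - zhat i).
Proof.
move=> Zz; split => [i k|i k||i]; first by rewrite ler0n.
- by rewrite addrC subrK.
- rewrite ler_wpM2l ?invr_ge0//; apply: ler_sum => i _.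
  by rewrite sum_indic addrC subrK.
- by have := sum_indic (kappa i) (fun=> 1); under eq_bigr do rewrite mulr1.
Qed.

Lemma objective_choice (kappa : 'I_N -> 'I_K) (z : 'I_N -> 'rV[R]_m) :
  objective (fun i k => (k == kappa i)%:R) (fun i k => z i - zhat i) =
  N%:R^-1 * \sum_i l (kappa i) (z i).
Proof.
congr (_ * _); apply: eq_bigr => i _.
by under eq_bigr do rewrite addrC subrK; rewrite sum_indic.
Qed.

Lemma feasible0 (k0 : 'I_K) s : 0 <= s ->
  feasible s (fun i k => (k == k0)%:R) (fun i k => zhat i - zhat i).
Proof.
move=> s0; have := feasible_choice (fun=> k0) Zzhat.
by apply: feasible_mono; rewrite big1 ?mulr0// => i _; exact: c_refl.
Qed.

Lemma dual_potential rho alpha v :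
  0 < rho -> optimal Z c zhat rho l alpha v ->
  exists lambda S, [/\ 0 <= lambda,
    forall i k z, Z z -> l k z <= lambda * c z (zhat i) + S (zhat i) &
    lambda * rho + N%:R^-1 * \sum_i S (zhat i) <= objective alpha v].
Proof.
move=> rho0 [feas opt]; set V := objective alpha v.
have k0 : 'I_K.
  have [K0|K0] := posnP K; last exact: (Ordinal K0).
  have [_ _ _ /(_ (Ordinal N0))] := feas; rewrite big1 => [/eqP|k _].
    by rewrite eq_sym oner_eq0.
  by have := ltn_ord k; rewrite {2}K0.
pose P s t := exists al w, feasible s al w /\ t = objective al w.
have [||||||lambda lambda0 hlambda] := @supergradient R P rho V 0
  (objective (fun i k => (k == k0)%:R) (fun i k => zhat i - zhat i)).
- move=> s1 t1 s2 t2 a b [al1 [w1 [f1 ->]]] [al2 [w2 [f2 ->]]] a0 b0 ab.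
  have [al [w [f h]]] := program_concave f1 f2 a0 b0 ab.
  by exists (objective al w) => //; exists al, w.
- move=> s s' t ss' [al [w [f ->]]]; exists al, w; split => //.
  exact: feasible_mono f.
- by [].
- by do 2 eexists; split; [exact: feasible0|].
- by exists alpha, v.
- by move=> t [al [w [f ->]]]; exact: opt.
pose E zh := [set r | exists k z, Z z /\ r = l k z - lambda * c z zh].
have NR : (0 : R) < N%:R by rewrite ltr0n.
have dual kappa (z : 'I_N -> 'rV[R]_m) : (forall i, Z (z i)) ->
    \sum_i (l (kappa i) (z i) - lambda * c (z i) (zhat i)) <= N%:R * (V - lambda * rho).
  move=> Zz.
  have := hlambda _ _
    (ex_intro _ _ (ex_intro _ _ (conj (feasible_choice kappa Zz) erefl))).
  rewrite objective_choice sumrB -mulr_sumr.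
  set A := \sum_i l _ _; set B := \sum_i c _ _ => h.
  have NK (x : R) : x = N%:R * (N%:R^-1 * x) by rewrite mulVKf ?gt_eqF.
  rewrite [A in leLHS]NK [B in leLHS]NK.
  rewrite [lambda * (_ * _)]mulrCA -mulrBr ler_pM2l//; lra.
have supE i : has_sup (E (zhat i)).
  split; first by eexists; exists k0, (zhat i); split; first exact: Zzhat.
  exists (N%:R * (V - lambda * rho) -
    \sum_(j | j != i) (l k0 (zhat j) - lambda * c (zhat j) (zhat j))).
  move=> _ [k [z [Zz ->]]].
  have := dual (fun j => if j == i then k else k0)
    (fun j => if j == i then z else zhat j).
  move=> /(_ _)/wrap[]; first by move=> j; case: ifP.
  rewrite (bigD1 i)//= !eqxx lerBrDr.
  rewrite [X in _ + X](eq_bigr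
    (fun j => l k0 (zhat j) - lambda * c (zhat j) (zhat j)))//.
  by move=> j /negPf ->.
exists lambda, (fun zh => sup (E zh)); split => //.
  move=> i k z Zz; rewrite -lerBlDl.
  by apply: ub_le_sup; [exact: (supE i).2|exists k, z].
apply/ler_addgt0Pr => e e0.
have /choice[f hf] : forall i, exists kz : 'I_K * 'rV[R]_m, Z kz.2 /\
    sup (E (zhat i)) - e < l kz.1 kz.2 - lambda * c kz.2 (zhat i).
  move=> i; have [_ [k [z [Zz ->]]] h] := sup_adherent e0 (supE i).
  by exists (k, z).
have := dual (fun i => (f i).1) (fun i => (f i).2) (fun i => (hf i).1).
have : \sum_i (sup (E (zhat i)) - e) <=
    \sum_i (l (f i).1 (f i).2 - lambda * c (f i).2 (zhat i)).
  by apply: ler_sum => i _; exact/ltW/(hf i).2.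
rewrite sumrB sumr_const card_ord => h1 h2.
have := le_trans h1 h2; rewrite -mulr_natl.
move: (\sum_i _) => A h.
rewrite -lerBrDl [leLHS]mulrC ler_pdivrMr// mulrC; lra.
Qed.

End Program.

(** * Sparse optimal solutions *)

Section Sparsity.
Variables (R : realType) (m N K : nat).
Variables (Z : set 'rV[R]_m) (c : 'rV[R]_m -> 'rV[R]_m -> R).
Variables (zhat : 'I_N -> 'rV[R]_m) (rho : R) (l : 'I_K -> 'rV[R]_m -> R).

Local Notation feasible := (feasible Z c zhat rho).
Local Notation objective := (objective zhat l).
Local Notation optimal := (optimal Z c zhat rho l).
Local Notation supp alpha := [pred ik : 'I_N * 'I_K | alpha ik.1 ik.2 != 0].

Lemma sumDdir (alpha d : 'I_N -> 'I_K -> R) (t : R) (F : 'I_N -> 'I_K -> R) :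
  \sum_i \sum_k (alpha i k + t * d i k) * F i k =
  \sum_i \sum_k alpha i k * F i k + t * \sum_i \sum_k d i k * F i k.
Proof.
rewrite mulr_sumr -big_split; apply: eq_bigr => i _ /=.
rewrite mulr_sumr -big_split; apply: eq_bigr => k _ /=.
by rewrite mulrDl mulrA.
Qed.

Lemma sum0_has_neg (I : finType) (f : I -> R) i :
  \sum_j f j = 0 -> f i != 0 -> exists j, f j < 0.
Proof.
move=> f0 fi; apply: contrapT => /forallNP h.
have f_ge0 j : true -> 0 <= f j by move=> _; rewrite leNgt; exact/negP.
by have := psumr_eq0P f_ge0 f0 (erefl : i \in predT) => fi0; rewrite fi0 eqxx in fi.
Qed.

Lemma ratio_test (alpha d : 'I_N -> 'I_K -> R) v :
    feasible alpha v ->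
    (forall i k, alpha i k = 0 -> d i k = 0) ->
    (forall i, \sum_k d i k = 0) ->
    \sum_i \sum_k d i k * c (zhat i + v i k) (zhat i) = 0 ->
    (exists i k, d i k < 0) ->
  exists t, [/\ 0 < t, feasible (fun i k => alpha i k + t * d i k) v &
    exists i k, alpha i k != 0 /\ alpha i k + t * d i k = 0].
Proof.
move=> [al0 Zv cost sum1] dsupp dsum dcost [i1 [k1 d1]].
have [ik0 /= dik0 hmin] := @arg_minP _ _ _ (i1, k1)
  (fun ik : 'I_N * 'I_K => d ik.1 ik.2 < 0)
  (fun ik => alpha ik.1 ik.2 / - d ik.1 ik.2) d1.
set t := alpha ik0.1 ik0.2 / - d ik0.1 ik0.2 in hmin.
have alpos i k : d i k < 0 -> 0 < alpha i k.
  move=> dik; rewrite lt_neqAle al0 andbT eq_sym; apply/eqP => /dsupp d0.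
  by rewrite d0 ltxx in dik.
have t0 : 0 < t by rewrite divr_gt0 ?oppr_gt0//; exact: alpos.
exists t; split => //.
- split => //.
  + move=> i k; have [dik|dik] := ltP (d i k) 0; last first.
      by apply: addr_ge0 => //; apply: mulr_ge0 => //; exact: ltW.
    have := hmin (i, k) dik; rewrite /= ler_pdivlMr ?oppr_gt0//; lra.
  + by rewrite sumDdir dcost mulr0 addr0.
  + by move=> i; rewrite big_split/= -mulr_sumr dsum mulr0 addr0.
- exists ik0.1, ik0.2; split; first by rewrite gt_eqF//; exact: alpos.
  by rewrite /t invrN mulrN mulNr divfK ?lt_eqF// subrr.
Qed.

(* [N.+1] linear equations in more than [N.+1] unknowns. *)
Lemma balanced_direction (alpha : 'I_N -> 'I_K -> R) v :
  (N.+1 < #|supp alpha|)%N -> exists d : 'I_N -> 'I_K -> R,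
    [/\ forall i k, alpha i k = 0 -> d i k = 0,
        forall i, \sum_k d i k = 0,
        \sum_i \sum_k d i k * c (zhat i + v i k) (zhat i) = 0 &
        exists i k, d i k != 0].
Proof.
move=> hA; set A := supp alpha in hA *.
pose e (r : 'I_#|A|) : 'I_N * 'I_K := enum_val r.
pose M := \matrix_(r < #|A|, j < N.+1)
  (if unlift ord0 j is Some i then ((e r).1 == i)%:R
   else c (zhat (e r).1 + v (e r).1 (e r).2) (zhat (e r).1)).
have /rowV0Pn[u usub u0] : kermx M != 0.
  rewrite -mxrank_eq0 mxrank_ker subn_eq0 -ltnNge.
  exact: leq_ltn_trans (rank_leq_col _) hA.
have uM : u *m M = 0 by exact/sub_kermxP.
pose d i k : R := \sum_r u 0 r * (e r == (i, k))%:R.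
have sumd (F : 'I_N * 'I_K -> R) :
    \sum_i \sum_k d i k * F (i, k) = \sum_r u 0 r * F (e r).
  rewrite (pair_bigA _ (fun i k => d i k * F (i, k)))/=.
  under eq_bigr do rewrite mulr_suml.
  rewrite exchange_big; apply: eq_bigr => r _ /=.
  rewrite (bigD1 (e r))//= -surjective_pairing eqxx mulr1 big1 ?addr0// => ik.
  by rewrite -surjective_pairing eq_sym => /negPf ->; rewrite mulr0 mul0r.
exists d; split.
- move=> i k al0; rewrite /d big1// => r _.
  have [er|] := eqVneq; last by rewrite mulr0.
  by have := enum_valP r; rewrite -/(e r) er inE/= al0 eqxx.
- move=> i.
  have /matrixP/(_ 0 (lift ord0 i)) := uM; rewrite !mxE => h.
  rewrite -[RHS]h; under [RHS]eq_bigr do rewrite mxE liftK.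
  rewrite -(sumd (fun jk => (jk.1 == i)%:R)) (bigD1 i)//= [X in _ + X]big1 ?addr0.
    by under [RHS]eq_bigr do rewrite eqxx mulr1.
  by move=> j /negPf ->; rewrite big1// => k _; rewrite mulr0.
- have /matrixP/(_ 0 ord0) := uM; rewrite !mxE => h.
  rewrite -[RHS]h; under [RHS]eq_bigr do rewrite mxE unlift_none.
  by rewrite -(sumd (fun ik => c (zhat ik.1 + v ik.1 ik.2) (zhat ik.1))).
have /rV0Pn[r ur] := u0.
exists (e r).1, (e r).2; rewrite /d -surjective_pairing (bigD1 r)//= eqxx mulr1.
rewrite big1 ?addr0// => s sr; rewrite [e s == _](_ : _ = false) ?mulr0//.
by apply/negbTE; apply: contra sr => /eqP /enum_val_inj ->.
Qed.

Lemma optimal_shrink alpha v : optimal alpha v -> (N.+1 < #|supp alpha|)%N ->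
  exists2 alpha', optimal alpha' v & (#|supp alpha'| < #|supp alpha|)%N.
Proof.
move=> [feas opt] /(balanced_direction v)[d [dsupp dsum dcost [i1 [k1 d1]]]].
have objD t : objective (fun i k => alpha i k + t * d i k) v =
    objective alpha v + t * (N%:R^-1 * \sum_i \sum_k d i k * l k (zhat i + v i k)).
  by rewrite /Defs.objective sumDdir mulrDr mulrCA.
have [k2 d2] := sum0_has_neg (dsum i1) d1.
have dNsum i : \sum_k - d i k = 0 by rewrite sumrN dsum oppr0.
have [k3 d3] : exists k, - d i1 k < 0.
  by apply: (sum0_has_neg (dNsum i1)); rewrite oppr_eq0; exact: d1.
have [t [t0 feast [i4 [k4 [al4 t4]]]]] := ratio_test feas dsupp dsum dcost
  (ex_intro _ i1 (ex_intro _ k2 d2)).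
have [s [s0 feass _]] : exists s, [/\ 0 < s,
    feasible (fun i k => alpha i k + s * - d i k) v & True].
  have [||s [s0 feass _]] := ratio_test feas _ dNsum _ (ex_intro _ i1 (ex_intro _ k3 d3)).
  - by move=> i k /dsupp ->; rewrite oppr0.
  - under eq_bigr do under eq_bigr do rewrite mulNr.
    by under eq_bigr do rewrite sumrN; rewrite sumrN dcost oppr0.
  - by exists s.
set o := N%:R^-1 * _ in objD.
have o0 : o = 0.
  have := opt _ _ feast; rewrite objD gerDl pmulr_rle0// => o1.
  have := opt _ _ feass.
  have -> : (fun i k => alpha i k + s * - d i k) = (fun i k => alpha i k + - s * d i k).
    by apply/funext => i; apply/funext => k; rewrite mulrN mulNr.
  rewrite objD gerDl mulNr oppr_le0 pmulr_rge0// => o2.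
  by apply/eqP; rewrite eq_le o1.
exists (fun i k => alpha i k + t * d i k).
  by split=> // al' v' /opt; rewrite objD o0 mulr0 addr0.
apply: proper_card; apply/properP; split.
  apply/fintype.subsetP => -[i k]; rewrite !inE/=; apply: contra => /eqP al0.
  by rewrite al0 dsupp// mulr0 addr0.
by exists (i4, k4); rewrite !inE/= ?t4 ?eqxx.
Qed.

Lemma optimal_sparse alpha v : optimal alpha v ->
  exists2 alpha', optimal alpha' v & (#|supp alpha'| <= N.+1)%N.
Proof.
have [n] := ubnP #|supp alpha|; elim: n alpha => // n IH alpha ltn opt.
have [le|gt] := leqP #|supp alpha| N.+1; first by exists alpha.
have [alpha' opt' lt] := optimal_shrink opt gt.
by apply: IH opt'; exact: leq_trans lt _.
Qed.

End Sparsity.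

(** * Existence of an optimal solution *)

Lemma ultra_fmap (S T : Type) (f : S -> T) (F : set_system S) :
  UltraFilter F -> UltraFilter (f @ F).
Proof.
move=> FU; split; first exact: fmap_proper_filter.
move=> G GF sFG; apply/seteqP; split => A; last exact: sFG.
move=> GA; have [//|FnA] := in_ultra_setVsetC (f @^-1` A) FU.
have /filter_ex[x []] : G (A `&` ~` A) by apply: filterI => //; exact: sFG.
by [].
Qed.

Section Existence.
Variables (R : realType) (m N K : nat).
Variables (Z : set 'rV[R]_m) (c : 'rV[R]_m -> 'rV[R]_m -> R).
Variables (zhat : 'I_N -> 'rV[R]_m) (l : 'I_K -> 'rV[R]_m -> R).
Hypotheses (N0 : (0 < N)%N) (Zzhat : forall i, Z (zhat i)).
Hypothesis c_ge0 : forall z zh, Z z -> Z zh -> 0 <= c z zh.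
Hypothesis c_refl : forall z, Z z -> c z z = 0.
Hypothesis c_lsc : forall z zh a, Z z -> Z zh -> a < c z zh ->
  \forall z' \near z, Z z' -> a < c z' zh.
Hypothesis Zclosed : closed Z.
Hypothesis l_cont : forall k, continuous (l k).
Variable C0 : R.
Hypothesis C0_ge0 : 0 <= C0.
Hypothesis c_coercive : forall z i, Z z -> `|z - zhat i| <= C0 * (1 + c z (zhat i)).
Hypothesis growth : forall e, 0 < e -> exists C, forall i k z, Z z ->
  l k z <= C + e * c z (zhat i).

Lemma atom_limit (U : set_system nat) (i : 'I_N) (k : 'I_K)
    (a : nat -> R) (z : nat -> 'rV[R]_m) (M : R) :
  UltraFilter U -> (forall n, 0 <= a n <= 1) -> (forall n, Z (z n)) ->
  (forall n, a n * c (z n) (zhat i) <= M) ->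
  exists (b : R) (y : 'rV[R]_m), [/\ 0 <= b, a @ U --> b, Z y &
    forall e, 0 < e -> \forall n \near U,
      a n * l k (z n) <= b * l k y + e /\
      b * c y (zhat i) <= a n * c (z n) (zhat i) + e].
Proof.
move=> UU a01 Zz aM.
have [b [b01 ab]] : `[0, 1]%classic `&` [set p | a @ U --> p] !=set0.
  have := @segment_compact R 0 1; rewrite compact_ultra; apply.
    exact: ultra_fmap.
  by apply: (@filterE _ U) => n /=; rewrite in_itv/= a01.
move: b01; rewrite /= in_itv/= => /andP[b0 b1].
have near_a d : 0 < d -> \forall n \near U, `|b - a n| <= d.
  by move=> d0; move: (ab : a @ U --> b) => /cvgrPdist_le; exact.
have cz0 n : 0 <= c (z n) (zhat i) by exact: c_ge0.
have a0 n : 0 <= a n by have /andP[] := a01 n.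
have M0 : 0 <= M by apply: le_trans (aM 0%N); rewrite mulr_ge0.
have [b_eq0|b_neq0] := eqVneq b 0.
  exists b, (zhat i); split => // e e0; rewrite b_eq0 !mul0r add0r.
  pose e1 := e / 2 / (M + 1).
  have e10 : 0 < e1 by rewrite !divr_gt0//; lra.
  have [C hC] := growth e10.
  pose C1 := `|C| + 1.
  have C10 : 0 < C1 by rewrite /C1; have := normr_ge0 C; lra.
  have CC1 : C <= C1 by rewrite /C1; have := ler_norm C; lra.
  have : \forall n \near U, a n <= e / 2 / C1.
    have := near_a (e / 2 / C1); rewrite !divr_gt0// => /(_ isT).
    by apply: filterS => n; rewrite b_eq0 sub0r normrN ger0_norm.
  apply: filterS => n; rewrite ler_pdivlMr// => an.
  have acn := aM n; have := hC i k _ (Zz n) => hl.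
  split; last by rewrite addr_ge0// ?mulr_ge0// ltW.
  have h1 := ler_wpM2l (a0 n) hl.
  apply: (le_trans h1); rewrite mulrDr.
  have h2 : a n * C <= a n * C1 by rewrite ler_wpM2l.
  have h3 : a n * (e1 * c (z n) (zhat i)) <= e / 2.
    rewrite mulrCA; apply: (@le_trans _ _ (e1 * M)); first by rewrite ler_wpM2l// ltW.
    rewrite /e1 mulrAC ler_pdivrMr; last lra.
    by rewrite ler_wpM2l ?divr_ge0 ?(ltW e0)//; lra.
  lra.
have bpos : 0 < b by rewrite lt_neqAle eq_sym b_neq0.
pose M1 := 2 * M / b.
have near_b : \forall n \near U, b / 2 <= a n.
  have := near_a (b / 2); rewrite divr_gt0// => /(_ isT).
  by apply: filterS => n; rewrite ler_norml => /andP[]; lra.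
pose B := [set y : 'rV[R]_m | `|y - zhat i| <= C0 * (1 + M1)] `&` Z.
have [y [By zy]] : B `&` [set p | z @ U --> p] !=set0.
  have : compact B.
    apply: bounded_closed_compact.
      exists (`|zhat i| + C0 * (1 + M1)); split; first exact: num_real.
      move=> M' hM' y [/= hy _].
      apply: le_trans (ltW hM'); rewrite -[y in `|y|](subrK (zhat i)).
      by rewrite (le_trans (ler_normD _ _))// addrC lerD2l.
    apply: closedI => //.
    have /= := @preimage_closed _ _ (fun y : 'rV[R]_m => `|y - zhat i|)
      [set x | x <= C0 * (1 + M1)].
    apply; last exact: closed_le.
    move=> y _.
    have h : (fun y : 'rV[R]_m => y - zhat i) @ y --> y - zhat i.
      exact: (@cvgB _ _ _ (nbhs y) _ id (cst (zhat i)) y (zhat i) cvg_id (cvg_cst _)).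
    exact: (@cvg_norm _ _ _ (nbhs y) _ _ _ h).
  rewrite compact_ultra; apply; first exact: ultra_fmap.
  rewrite /fmap/=; apply: filterS near_b => n an; split => //=.
  apply: (le_trans (c_coercive i (Zz n))); rewrite ler_wpM2l// lerD2l.
  rewrite /M1 ler_pdivlMr// -ler_pdivrMl//.
  apply: le_trans (aM n); rewrite mulrCA mulrC ler_wpM2r// mulrC; lra.
have Zy : Z y := By.2.
exists b, y; split => // e e0.
have cy0 : 0 <= c y (zhat i) by exact: c_ge0.
pose e1 := e / (1 + c y (zhat i)).
have e10 : 0 < e1 by rewrite divr_gt0//; lra.
have H1 : \forall n \near U, a n * l k (z n) <= b * l k y + e.
  have : (fun n => a n * l k (z n)) @ U --> b * l k y.
    apply: cvgM => //; exact: (@cvg_comp _ _ _ z (l k) U (nbhs y) _ zy (@l_cont k y)).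
  move=> /cvgrPdist_le/(_ e e0); apply: filterS => n; rewrite ler_norml => /andP[]; lra.
have H2 : \forall n \near U, c y (zhat i) - e1 < c (z n) (zhat i).
  have : c y (zhat i) - e1 < c y (zhat i) by lra.
  move=> /(c_lsc Zy (Zzhat i)) /zy h.
  by apply: (@filterS _ U _ _ _ _ h) => n; apply; exact: Zz.
have H3 : \forall n \near U, b - e1 <= a n.
  apply: filterS (near_a _ e10) => n; rewrite ler_norml => /andP[]; lra.
near=> n; split; first by near: n.
have h2 : c y (zhat i) - e1 < c (z n) (zhat i) by near: n.
have h3 : b - e1 <= a n by near: n.
have /andP[_ a1] := a01 n.
have ee : e = e1 * (1 + c y (zhat i)) by rewrite /e1 divfK// gt_eqF//; lra.
have := ler_wpM2l (a0 n) (ltW h2).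
have := ler_wpM2r cy0 h3.
have := ler_wpM2r (ltW e10) a1.
rewrite ee; lra.
Unshelve. all: end_near. Qed.

Lemma optimal_exists rho : (0 < K)%N -> 0 <= rho ->
  exists alpha v, optimal Z c zhat rho l alpha v.
Proof.
move=> K0 rho0; have NR : (0 : R) < N%:R by rewrite ltr0n.
pose P := [set av : ('I_N -> 'I_K -> R) * ('I_N -> 'I_K -> 'rV[R]_m) |
  feasible Z c zhat rho av.1 av.2].
pose obj (av : ('I_N -> 'I_K -> R) * ('I_N -> 'I_K -> 'rV[R]_m)) :=
  objective zhat l av.1 av.2.
have supobj : has_sup (obj @` P).
  split.
    eexists; exists (fun i k => (k == Ordinal K0)%:R, fun i k => zhat i - zhat i) => //.
    exact: feasible0.
  have [C hC] := growth ltr01.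
  exists (C + rho) => _ [[al w] [/= al0 Zw cost sum1] <-].
  rewrite /obj/=; apply: le_trans (lerD (lexx C) cost).
  have -> : C = N%:R^-1 * \sum_(i < N) \sum_k al i k * C.
    under eq_bigr do rewrite -mulr_suml sum1 mul1r.
    by rewrite sumr_const card_ord -[C *+ _]mulr_natl mulKf ?gt_eqF.
  rewrite -mulrDr ler_wpM2l ?invr_ge0// -big_split; apply: ler_sum => i _ /=.
  rewrite -big_split; apply: ler_sum => k _ /=.
  by rewrite -mulrDr ler_wpM2l// (le_trans (hC i k _ (Zw i k)))// mul1r.
set V := sup (obj @` P).
have /choice[s hs] : forall n : nat, exists av, P av /\ V - n.+1%:R^-1 < obj av.
  move=> n; have n0 : (0 : R) < n.+1%:R^-1 by rewrite invr_gt0.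
  by have [_ [av Pav <-] h] := sup_adherent n0 supobj; exists av.
have [U [UU sU]] := @ultraFilterLemma nat \oo eventually_filter.
pose a i k n := (s n).1 i k; pose z i k n := zhat i + (s n).2 i k.
have a0 i k n : 0 <= a i k n by have [[h _ _ _] _] := hs n; exact: h.
have Zz i k n : Z (z i k n) by have [[_ h _ _] _] := hs n; exact: h.
have asum i n : \sum_k a i k n = 1 by have [[_ _ _ h] _] := hs n; exact: h.
have a1 i k n : a i k n <= 1 by rewrite -(asum i n) (bigD1 k)//= lerDl sumr_ge0.
have cost n : \sum_i \sum_k a i k n * c (z i k n) (zhat i) <= N%:R * rho.
  by rewrite -ler_pdivrMl//; have [[_ _ h _] _] := hs n; exact: h.
have acz0 i k n : 0 <= a i k n * c (z i k n) (zhat i) by rewrite mulr_ge0 ?c_ge0.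
have acost i k n : a i k n * c (z i k n) (zhat i) <= N%:R * rho.
  apply: le_trans (cost n); rewrite (bigD1 i)//= (bigD1 k)//= -addrA lerDl.
  by rewrite addr_ge0 ?sumr_ge0// => j _; rewrite sumr_ge0.
have /choice[blim hb] : forall ik : 'I_N * 'I_K, exists yl : R * 'rV[R]_m,
    [/\ 0 <= yl.1, a ik.1 ik.2 @ U --> yl.1, Z yl.2 & forall e, 0 < e ->
    \forall n \near U,
      a ik.1 ik.2 n * l ik.2 (z ik.1 ik.2 n) <= yl.1 * l ik.2 yl.2 + e /\
      yl.1 * c yl.2 (zhat ik.1) <=
        a ik.1 ik.2 n * c (z ik.1 ik.2 n) (zhat ik.1) + e].
  move=> [i k] /=; have [|||b [y h]] := @atom_limit U i k (a i k) (z i k) (N%:R * rho) UU.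
  - by move=> n; rewrite a0 a1.
  - exact: Zz.
  - exact: acost.
  - by exists (b, y).
pose b i k := (blim (i, k)).1; pose y i k := (blim (i, k)).2.
have near_all e : 0 < e -> \forall n \near U, forall ik : 'I_N * 'I_K,
    a ik.1 ik.2 n * l ik.2 (z ik.1 ik.2 n) <= b ik.1 ik.2 * l ik.2 (y ik.1 ik.2) + e /\
    b ik.1 ik.2 * c (y ik.1 ik.2) (zhat ik.1) <=
      a ik.1 ik.2 n * c (z ik.1 ik.2 n) (zhat ik.1) + e.
  move=> e0; apply: filter_forall => -[i k].
  by have [_ _ _ /(_ e e0)] := hb (i, k).
have sume (F : 'I_N -> 'I_K -> R) e :
    N%:R^-1 * \sum_i \sum_k (F i k + e) =
    N%:R^-1 * (\sum_i \sum_k F i k) + K%:R * e.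
  under eq_bigr do rewrite big_split/= sumr_const card_ord -[e *+ _]mulr_natl.
  by rewrite big_split/= sumr_const card_ord -[(K%:R * e) *+ N]mulr_natl
    mulrDr mulKf ?gt_eqF.
have zE i k : zhat i + (y i k - zhat i) = y i k by rewrite addrC subrK.
have KR : (0 : R) < K%:R + 1 by rewrite ltr_wpDl.
exists b, (fun i k => y i k - zhat i); split.
  split.
  - by move=> i k; have [] := hb (i, k).
  - by move=> i k; rewrite zE; have [] := hb (i, k).
  - apply/ler_addgt0Pr => e e0.
    have e1 : 0 < e / (K%:R + 1) by rewrite divr_gt0.
    have [n hn] := filter_ex (near_all _ e1).
    apply: (@le_trans _ _
      (N%:R^-1 * \sum_i \sum_k (a i k n * c (z i k n) (zhat i) + e / (K%:R + 1)))).
      rewrite ler_wpM2l ?invr_ge0//; apply: ler_sum => i _; apply: ler_sum => k _.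
      by rewrite zE; exact: (hn (i, k)).2.
    rewrite sume lerD//; first by rewrite ler_pdivrMl.
    by rewrite mulrCA ger_pMr// ler_pdivrMr// mul1r lerDl.
  - move=> i; apply: (@cvg_unique _ _ ((fun n => \sum_k a i k n) @ U)) => //.
      apply: cvg_big => [|k _]; first exact: add_continuous.
      by have [] := hb (i, k).
    have -> : (fun n => \sum_k a i k n) = cst 1 by apply/funext => n; exact: asum.
    exact: cvg_cst.
move=> al w feas.
have : objective zhat l al w <= V.
  by apply: ub_le_sup; [exact: supobj.2|exists (al, w)].
move/le_trans; apply; apply/ler_addgt0Pr => e e0.
have e1 : 0 < e / 2 / (K%:R + 1) by rewrite !divr_gt0.
have hnear : \forall n \near U, n.+1%:R^-1 < e / 2.
  apply: sU; have /cvgrPdist_lt/(_ (e / 2)) := @cvg_harmonic R.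
  rewrite divr_gt0// => /(_ isT); apply: filterS => n /=.
  by rewrite sub0r normrN ger0_norm.
have [n [hn hn2]] := filter_ex (filterI (near_all _ e1) hnear).
have [_ /ltW] := hs n; rewrite lerBlDr => h; apply: (le_trans h).
have : obj (s n) <=
    objective zhat l b (fun i k => y i k - zhat i) + K%:R * (e / 2 / (K%:R + 1)).
  rewrite -sume ler_wpM2l ?invr_ge0//; apply: ler_sum => i _; apply: ler_sum => k _.
  by rewrite zE; exact: (hn (i, k)).1.
have : K%:R * (e / 2 / (K%:R + 1)) <= e / 2.
  by rewrite mulrCA ger_pMr ?divr_gt0// ler_pdivrMr// mul1r lerDl.
move=> Ke objn; apply: (le_trans (lerD objn (ltW hn2))).
by rewrite -addrA lerD2l (le_trans (lerD Ke (lexx _)))// -splitr lexx.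
Qed.

End Existence.

(** * Growth of the loss *)

Lemma powR_lower_growth (R : realType) (p r e : R) : 0 <= r -> r < p -> 0 < e ->
  exists2 C, 0 <= C & forall t, 0 <= t -> t `^ r <= C + e * t `^ p.
Proof.
move=> r0 rp e0; pose T0 := e^-1 `^ (p - r)^-1.
exists (T0 `^ r) => [|t t0]; first exact: powR_ge0.
have [tT|tT] := leP t T0.
  apply: (@le_trans _ _ (T0 `^ r)); first by rewrite ge0_ler_powR ?nnegrE ?powR_ge0.
  by rewrite lerDl mulr_ge0 ?powR_ge0// ltW.
have tpos : 0 < t by apply: le_lt_trans tT; exact: powR_ge0.
rewrite -[p](subrK r) powRD; last by rewrite (gt_eqF tpos) implybT.
have h : e^-1 <= t `^ (p - r).
  have -> : e^-1 = T0 `^ (p - r).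
    by rewrite /T0 -powRrM mulVf ?powRr1 ?invr_ge0 ?ltW// gt_eqF// subr_gt0.
  by rewrite ge0_ler_powR ?nnegrE ?powR_ge0 ?subr_ge0// ltW.
rewrite mulrA ler_wpDl ?powR_ge0// ler_peMl ?powR_ge0//.
by rewrite -ler_pdivrMl// mulr1.
Qed.

Section Growth.
Variables (R : realType) (m N K : nat).
Variables (Z : set 'rV[R]_m) (c : 'rV[R]_m -> 'rV[R]_m -> R).
Variables (zhat : 'I_N -> 'rV[R]_m) (l : 'I_K -> 'rV[R]_m -> R).
Variables (nrm : 'rV[R]_m -> R) (p : R).
Hypotheses (Zzhat : forall i, Z (zhat i)) (nrm_norm : is_norm nrm) (p1 : 1 <= p).
Hypothesis nrm_c : forall z zh, Z z -> Z zh -> nrm (z - zh) `^ p <= c z zh.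

Lemma cost_coercive : exists2 C, 0 <= C &
  forall z i, Z z -> `|z - zhat i| <= C * (1 + c z (zhat i)).
Proof.
have [C C0 hC] := norm_le_is_norm nrm_norm.
exists C => [|z i Zz]; first exact: ltW.
apply: (le_trans (hC _)); rewrite ler_pM2l//.
apply: (le_trans _ (lerD (lexx 1) (nrm_c Zz (Zzhat i)))).
have [n1|/ltW n1] := leP (nrm (z - zhat i)) 1.
  by rewrite (le_trans n1)// lerDl powR_ge0.
rewrite ler_wpDl// -[leLHS]powRr1 ?is_norm_ge0//.
by rewrite ler_powR.
Qed.

Hypothesis l_ccv : forall k, convex_function setT (fun z => - l k z).

Lemma loss_growth :
    (p = 1 -> exists (g : R) (zh0 : 'rV[R]_m) (r : R), [/\ 0 < g, 0 <= r < 1 &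
      forall k z, Z z -> l k z <= g * (1 + nrm (z - zh0) `^ r)]) ->
  forall e, 0 < e -> exists C, forall i k z, Z z ->
    l k z <= C + e * c z (zhat i).
Proof.
move=> hp e e0; have [tri hom sep] := nrm_norm.
suff : forall ik : 'I_N * 'I_K, exists C, forall z, Z z ->
    l ik.2 z <= C + e * c z (zhat ik.1).
  move=> /choice[C hC]; exists (\sum_ik `|C ik|) => i k z Zz.
  apply: (le_trans (hC (i, k) z Zz)); rewrite lerD2r (bigD1 (i, k))//=.
  by rewrite (le_trans (ler_norm _))// lerDl sumr_ge0.
move=> [i k] /=; have [p_eq1|p_neq1] := eqVneq p 1.
  have [g [zh0 [r [g0 /andP[r0 r1] hl]]]] := hp p_eq1.
  have eg : 0 < e / g by rewrite divr_gt0.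
  have [C C0 hC] := powR_lower_growth r0 r1 eg.
  exists (g + g * C + e * nrm (zhat i - zh0)) => z Zz.
  apply: (le_trans (hl k z Zz)).
  have := hC _ (is_norm_ge0 (z - zh0) nrm_norm).
  rewrite powRr1 ?is_norm_ge0// => h1.
  have h2 : nrm (z - zh0) <= nrm (z - zhat i) + nrm (zhat i - zh0).
    by have := tri (z - zhat i) (zhat i - zh0); rewrite addrA subrK.
  have := nrm_c Zz (Zzhat i); rewrite p_eq1 powRr1 ?is_norm_ge0// => h3.
  have h4 : g * nrm (z - zh0) `^ r <= g * C + e * nrm (z - zh0).
    apply: (le_trans (ler_wpM2l (ltW g0) h1)).
    by rewrite mulrDr [g * (_ * _)]mulrA [g * _]mulrC divfK ?gt_eqF.
  have h5 := ler_wpM2l (ltW e0) h2; have h6 := ler_wpM2l (ltW e0) h3.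
  lra.
have p_gt1 : 1 < p by rewrite lt_neqAle eq_sym p_neq1.
have [B [B0 hB _]] := convex_local_lipschitz (zhat i) (@l_ccv k).
have [C C0 hC] := norm_le_is_norm nrm_norm.
have BC0 : 0 <= B * C by rewrite mulr_ge0// ltW.
have e1 : 0 < e / (B * C + 1) by rewrite divr_gt0//; lra.
have [D D0 hD] := powR_lower_growth ler01 p_gt1 e1.
exists (l k (zhat i) + (B * C + 1) * D) => z Zz.
have := hB (z - zhat i); rewrite [_ + (z - _)]addrC subrK => h1.
have h2 := ler_wpM2l B0 (hC (z - zhat i)).
have := hD _ (is_norm_ge0 (z - zhat i) nrm_norm).
rewrite powRr1 ?is_norm_ge0// => h3.
have n0 := is_norm_ge0 (z - zhat i) nrm_norm.
have h4 : (B * C + 1) * nrm (z - zhat i) <=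
    (B * C + 1) * D + e * nrm (z - zhat i) `^ p.
  apply: (le_trans (ler_wpM2l _ h3)); first lra.
  rewrite mulrDr [(B * C + 1) * (_ * _)]mulrA
    [(B * C + 1) * (e / _)]mulrC divfK// gt_eqF//.
  lra.
have h5 := ler_wpM2l (ltW e0) (nrm_c Zz (Zzhat i)).
rewrite mulrA in h2; lra.
Qed.

End Growth.

(** * Weak duality and attainment *)

Section Transport.
Variables (R : realType) (m N : nat).
Local Notation T := (borel_rV R m).
Variables (Z : set 'rV[R]_m) (c : 'rV[R]_m -> 'rV[R]_m -> R).
Variables (zhat : 'I_N -> 'rV[R]_m).
Hypotheses (N0 : (0 < N)%N) (Zzhat : forall i, Z (zhat i)).
Hypothesis c_ge0 : forall z zh, Z z -> Z zh -> 0 <= c z zh.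
Hypothesis c_meas : measurable_fun (Z `*` Z : set (T * T)%type)
  (fun w : T * T => (c w.1 w.2)%:E).
Hypothesis Zmeas : measurable (Z : set T).
Local Open Scope ereal_scope.

Let NR : (0 < N%:R :> R)%R. Proof. by rewrite ltr0n. Qed.

Lemma weak_duality (f S : 'rV[R]_m -> R) (lambda B : R) (Q : probability T R)
    (gamma : probability (T * T)%type R) :
    measurable_fun setT (f : T -> R) -> (0 <= lambda)%R ->
    (forall i z, Z z -> f z <= lambda * c z (zhat i) + S (zhat i))%R ->
    Q Z = 1 -> coupling Q (empirical zhat) gamma ->
    \int[gamma]_(w in Z `*` Z) (c w.1 w.2)%:E <= B%:E ->
  \int[Q]_(z in Z) (f z)%:E <=
    (lambda * B + N%:R^-1 * \sum_i S (zhat i))%:E.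
Proof.
move=> mf lambda0 hf QZ gammaQ cB.
have w0 (i : 'I_N) : (0 <= (N%:R^-1 : R))%R by rewrite invr_ge0.
have w1 : (\sum_(i < N) (N%:R^-1 : R) = 1)%R.
  by rewrite sumr_const card_ord -[(_ *+ N)%R]mulr_natl divff// gt_eqF.
have [P [PE intP]] := discrete_probability_exists (zhat : 'I_N -> T) w0 w1.
have P_emp A : measurable A -> P A = empirical zhat A by move=> /PE.
pose Y : set T := range zhat.
have finY : finite_set Y by exact: finite_image.
have mfin (A : set T) : A `<=` Y -> measurable A.
  move=> AY; apply: countable_measurable; first exact: measurable_set1_rV.
  exact/finite_set_countable/(sub_finite_set AY).
have mY : measurable Y by exact: mfin.
have Yzhat i : Y (zhat i) by exists i.
have mS (g : T -> \bar R) : measurable_fun Y g.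
  by move=> _ B' _; apply: mfin; exact: subIsetl.
have PY : P Y = 1.
  rewrite PE//; under eq_bigr do rewrite diracE mem_set// mule1.
  by rewrite sumEFin w1.
pose D : set (T * T)%type := Z `*` Y.
have mD : measurable D by exact: measurableX.
have mZT : measurable (Z `*` setT : set (T * T)%type) by exact: measurableX.
have mTY : measurable (setT `*` Y : set (T * T)%type) by exact: measurableX.
have gD : gamma D = 1.
  have gZ : gamma (~` (Z `*` setT)) = 0.
    by rewrite probability_setC// (gammaQ _ Zmeas).1 QZ subee.
  have gY : gamma (~` (setT `*` Y)) = 0.
    by rewrite probability_setC// (gammaQ _ mY).2 -P_emp// PY subee.
  have DE : D = ~` (~` (Z `*` setT) `|` ~` (setT `*` Y)).
    by rewrite setCU !setCK -setXI setIT setTI.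
  rewrite DE probability_setC; last by apply: measurableU; exact: measurableC.
  by rewrite null_set_setU ?sube0//; exact: measurableC.
have margQ (g : T -> \bar R) : measurable_fun (Z : set T) g ->
    \int[Q]_(y in Z) g y = \int[gamma]_(x in D) g x.1.
  move=> mg; apply: (@integral_marginal _ _ _ _ _ gamma Q fst D Z g) => //.
    by move=> x [].
  move=> A mA; rewrite -(gammaQ _ mA).1; congr (gamma _).
  by apply/seteqP; split=> x //= [].
have margP (g : T -> \bar R) : \int[P]_(y in Y) g y = \int[gamma]_(x in D) g x.2.
  apply: (@integral_marginal _ _ _ _ _ gamma P snd D Y g) => //.
    by move=> x [].
  move=> A mA; rewrite P_emp// -(gammaQ _ mA).2; congr (gamma _).
  by apply/seteqP; split=> x //= [].
rewrite margQ; last exact/measurable_funTS/measurable_EFinP.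
have DZZ : D `<=` Z `*` Z by move=> w [Zw [i _ wi]]; split => //; rewrite -wi.
have mcD : measurable_fun D (fun w : T * T => (c w.1 w.2)%:E).
  by apply: measurable_funS c_meas => //; exact: measurableX.
have c0 w : (Z `*` Z) w -> 0 <= (c w.1 w.2)%:E.
  by move=> [? ?]; rewrite lee_fin c_ge0.
have cDB : \int[gamma]_(w in D) (c w.1 w.2)%:E <= B%:E.
  apply: le_trans cB; apply: ge0_subset_integral => //; exact: measurableX.
have icD : gamma.-integrable D (fun w : T * T => (c w.1 w.2)%:E).
  apply/integrableP; split => //.
  apply: le_lt_trans (ltry B); apply: le_trans cDB.
  rewrite le_eqVlt; apply/orP; left; apply/eqP; apply: eq_integral.
  by move=> w /set_mem/DZZ/c0; exact: gee0_abs.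
have mSD : measurable_fun D (fun w : T * T => (S w.2)%:E).
  apply: (measurable_comp mY _ (mS (fun y => (S y)%:E))).
    by move=> _ [w [_ ?] <-].
exact: measurable_funTS.
have iSD : gamma.-integrable D (fun w : T * T => (S w.2)%:E).
  apply/integrableP; split => //.
  have := margP (fun y => (`|S y|%R)%:E); rewrite /= => <-.
  rewrite intP//; first exact: ltry.
  exact/measurable_EFinP.
pose h (w : T * T) : \bar R := lambda%:E * (c w.1 w.2)%:E + (S w.2)%:E.
have mh : measurable_fun D h.
  by apply: emeasurable_funD => //; exact: measurable_funeM.
have fh w : D w -> (f w.1)%:E <= h w.
  by move=> [Zw [i _ wi]]; rewrite /h -wi -EFinM -EFinD lee_fin hf.
apply: (@le_trans _ _ (\int[gamma]_(w in D) h w)).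
  have mf1 : measurable_fun D (fun w : T * T => (f w.1)%:E).
    apply/measurable_EFinP; apply: measurable_funTS.
    exact: (measurableT_comp mf measurable_fst).
  rewrite integralE [leRHS]integralE leeB//.
  - apply: ge0_le_integral => //; [exact: measurable_funepos|exact: measurable_funepos|].
    move=> w /fh fhw; rewrite !funeposE.
    by rewrite ge_max le_max fhw/= le_max lexx orbT.
  - apply: ge0_le_integral => //; [exact: measurable_funeneg|exact: measurable_funeneg|].
    move=> w /fh fhw; rewrite !funenegE.
    by rewrite ge_max le_max leeN2 fhw/= le_max lexx orbT.
rewrite integralD//; last exact: integrableZl.
rewrite integralZl//; have := margP (fun y => (S y)%:E); rewrite /= => <-.
rewrite intP//; last exact/measurable_EFinP.
rewrite EFinD leeD//; first by rewrite EFinM lee_wpmul2l.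
by rewrite -mulr_sumr.
Qed.

Lemma feasible_distribution (K : nat) (rho : R) alpha v :
  @feasible R m N K Z c zhat rho alpha v ->
  exists Q : probability T R,
    [/\ forall A, measurable A -> Q A = program_distribution zhat alpha v A,
        ambiguity_set Z c zhat rho Q &
        forall f : 'rV[R]_m -> R, measurable_fun setT (f : T -> R) ->
          \int[Q]_(z in Z) (f z)%:E =
          (N%:R^-1 * \sum_i \sum_k alpha i k * f (zhat i + v i k))%:E].
Proof.
move=> [al0 Zv cost sum1].
pose w (ik : 'I_N * 'I_K) : R := (N%:R^-1 * alpha ik.1 ik.2)%R.
pose z (ik : 'I_N * 'I_K) : T := (zhat ik.1 + v ik.1 ik.2)%R.
have w0 ik : (0 <= w ik)%R by rewrite mulr_ge0// invr_ge0.
have wsum (F : 'I_N -> 'I_K -> R) : (\sum_ik w ik * F ik.1 ik.2 =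
    N%:R^-1 * \sum_i \sum_k alpha i k * F i k)%R.
  rewrite (pair_bigA _ (fun i k => alpha i k * F i k)%R) mulr_sumr/=.
  by apply: eq_bigr => ik _; rewrite mulrA.
have w1 : (\sum_ik w ik = 1)%R.
  transitivity (\sum_ik w ik * 1)%R; first by apply: eq_bigr => ik _; rewrite mulr1.
  rewrite (wsum (fun _ _ => 1%R)); under eq_bigr do under eq_bigr do rewrite mulr1.
  under eq_bigr do rewrite sum1.
  by rewrite sumr_const card_ord -[(_ *+ N)%R]mulr_natl mulr1 mulVf// gt_eqF.
have [Q [QE intQ]] := discrete_probability_exists z w0 w1.
have [gamma [gE intg]] := discrete_probability_exists
  (fun ik => (z ik, (zhat ik.1 : T)) : (T * T)%type) w0 w1.
exists Q; split.
- by move=> A mA; rewrite QE.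
- split.
    rewrite QE// -[RHS](congr1 EFin w1) -sumEFin; apply: eq_bigr => ik _.
    by rewrite diracE mem_set ?mule1//; exact: Zv.
  apply: (@le_trans _ _ (\int[gamma]_(u in Z `*` Z) (c u.1 u.2)%:E)).
    apply: ereal_inf_lbound; exists gamma => //.
    move=> A mA; split.
      rewrite gE; last exact: measurableX.
      by rewrite QE//; apply: eq_bigr => ik _; rewrite !diracE in_setX in_setT andbT.
    rewrite gE; last exact: measurableX.
    transitivity (\sum_i \sum_k (w (i, k))%:E * \d_(zhat i : T) A).
      rewrite pair_bigA; apply: eq_bigr => -[i k] _ /=.
      by rewrite !diracE in_setX in_setT.
    apply: eq_bigr => i _.
    rewrite -ge0_sume_distrl; last by move=> k _; rewrite lee_fin.
    by rewrite sumEFin -mulr_sumr sum1 mulr1.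
  rewrite (intg _ (fun u => c u.1 u.2)).
  - by rewrite lee_fin (wsum (fun i k => c (zhat i + v i k) (zhat i))%R).
  - exact: measurableX.
  - by move=> ik; split; [exact: Zv|exact: Zzhat].
  - exact/measurable_EFinP.
- move=> f mf; rewrite intQ.
  + by rewrite -(wsum (fun i k => f (zhat i + v i k))%R).
  + exact: Zmeas.
  + by move=> ik; exact: Zv.
  + exact: measurable_funTS.
Qed.

End Transport.

Lemma max_ofE (R : realType) (K : nat) (k0 : 'I_K) (f : 'I_K -> R) :
  max_of f = (\big[Num.max/f k0]_k f k)%:E.
Proof.
apply/eqP; rewrite eq_le; apply/andP; split.
  apply: bigmax_le => [|k _]; first exact: leNye.
  by rewrite lee_fin; exact: le_bigmax.
rewrite -EFin_bigmax; apply: bigmax_le => [|k _];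
  exact: (le_bigmax _ (fun k => (f k)%:E)).
Qed.

Lemma cost_lsc (R : realType) (m : nat) (Z : set 'rV[R]_m)
    (c : 'rV[R]_m -> 'rV[R]_m -> R) : transportation_cost Z c ->
  forall z zh a, Z z -> Z zh -> a < c z zh ->
  \forall z' \near z, Z z' -> a < c z' zh.
Proof.
move=> [_ lsc _ _] z zh a Zz Zzh acz.
have [V Vz hV] := lsc (z, zh) a acz.
have ZZ : (Z `*` Z) (z, zh) by [].
have : within (Z `*` Z) (nbhs (z, zh)) V.
  by rewrite (nbhs_subspace_in ZZ).
rewrite /within/= => -[[U1 U2] /= [U1z U2z] UV].
apply: filterS U1z => z' U1z' Zz'.
by apply: (hV (z', zh)); apply: UV; split => //=; exact: nbhs_singleton.
Qed.

Theorem proposition1 (R : realType) (n m N K : nat)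
    (X : set 'rV[R]_n) (Z : set 'rV[R]_m)
    (c : 'rV[R]_m -> 'rV[R]_m -> R)
    (zhat : 'I_N -> 'rV[R]_m) (rho : R)
    (l : 'I_K -> 'rV[R]_n -> 'rV[R]_m -> R)
    (loss := fun (x : 'rV[R]_n) (z : 'rV[R]_m) => max_of (fun k => l k x z))
    (hc : transportation_cost Z c)
    (hN : (0 < N)%N) (hzhat : forall i, Z (zhat i)) (hrho : 0 < rho)
    (hX0 : X !=set0) (hXconvex : convex_set X)
    (hinfcompact : exists (Q0 : probability (borel_rV R m) R) (x0 : 'rV[R]_n),
       [/\ ambiguity_set Z c zhat rho Q0,
           X x0,
           forall a : R,
             compact [set x | X x /\ (expected_loss Z (loss x) Q0 <= a%:E)%E] &
           (-oo < expected_loss Z (loss x0) Q0)%E])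
    (hZ0 : Z !=set0) (hZclosed : closed Z) (hZconvex : convex_set Z)
    (hK : (2 <= K)%N)
    (hlconvex : forall k z, convex_function setT (fun x => l k x z))
    (hlconcave : forall k x, convex_function setT (fun z => - l k x z))
    (hgrowth : exists (nrm : 'rV[R]_m -> R) (p : R),
       [/\ is_norm nrm,
           1 <= p,
           forall z zh, Z z -> Z zh -> nrm (z - zh) `^ p <= c z zh &
           p = 1 -> forall x, X x -> exists (g : R) (zh0 : 'rV[R]_m) (r : R),
             [/\ 0 < g, Z zh0, 0 <= r < 1 &
                 forall z, Z z ->
                   (loss x z <= (g * (1 + nrm (z - zh0) `^ r))%:E)%E]])
    (x : 'rV[R]_n) (hx : X x) :
  [/\ ereal_sup [set expected_loss Z (loss x) Q |
                 Q in ambiguity_set Z c zhat rho] =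
      ereal_sup [set y : \bar R | exists alpha v,
                 feasible Z c zhat rho alpha v /\
                 y = (objective zhat (fun k => l k x) alpha v)%:E],
      forall alpha v, optimal Z c zhat rho (fun k => l k x) alpha v ->
        exists Q : probability (borel_rV R m) R,
          (forall A, measurable A -> Q A = program_distribution zhat alpha v A)
          /\ worst_case_distribution Z c zhat rho (loss x) Q,
      exists alpha v, optimal Z c zhat rho (fun k => l k x) alpha v /\
        (#|[pred ik : 'I_N * 'I_K | alpha ik.1 ik.2 != 0%R]| <= N.+1)%N &
      exists (Q : probability (borel_rV R m) R) (s : seq 'rV[R]_m),
        [/\ worst_case_distribution Z c zhat rho (loss x) Q,
            (size s <= N.+1)%N & Q [set` s] = 1%E]].
Proof.
have [nrm [p [nn p1 nrm_c hp]]] := hgrowth.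
have K0 : (0 < K)%N by exact: ltn_trans hK.
have [c_ge0 c_lsc0 c_refl c_cvx] := hc.
have c_lsc := cost_lsc hc.
pose k0 := Ordinal K0; pose lx k := l k x.
pose lr z := \big[Num.max/lx k0 z]_k lx k z.
have lossE : loss x = fun z => (lr z)%:E by apply/funext => z; exact: max_ofE.
have l_le k z : lx k z <= lr z by exact: (le_bigmax _ (fun k => lx k z)).
have lx_ccv k : convex_function setT (fun z => - lx k z) by exact: hlconcave.
have lx_cont k : continuous (lx k).
  move=> z; have := continuousN (@convex_continuous _ _ _ (lx_ccv k) z).
  rewrite [X in {for z, continuous X} -> _](_ : _ = lx k)//.
  by apply/funext => y /=; rewrite opprK.
have lr_meas : measurable_fun setT (lr : borel_rV R m -> R).
  rewrite /lr; elim: (index_enum 'I_K) => [|k s IH].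
    under eq_fun do rewrite big_nil; exact: continuous_measurable_rV.
  under eq_fun do rewrite big_cons.
  by apply: measurable_maxr => //; exact: continuous_measurable_rV.
have Zmeas := closed_measurable_rV hZclosed.
have c_meas : measurable_fun (Z `*` Z : set (borel_rV R m * borel_rV R m)%type)
    (fun w : borel_rV R m * borel_rV R m => (c w.1 w.2)%:E).
  by apply: lower_semicontinuous_measurable_rV => //; exact: measurableX.
have growth : forall e, 0 < e -> exists C, forall i k z, Z z ->
    lx k z <= C + e * c z (zhat i).
  apply: (loss_growth hzhat nn p1 nrm_c lx_ccv) => p_eq1.
  have [g [zh0 [r [g0 Zzh0 r01 hg]]]] := hp p_eq1 x hx.
  exists g, zh0, r; split => // k z Zz.
  apply: le_trans (l_le k z) _; rewrite -lee_fin.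
  by have := hg z Zz; rewrite lossE.
have [C C0 coercive] := cost_coercive hzhat nn p1 nrm_c.
have [al1 [v1 opt1]] :=
  optimal_exists hN hzhat c_ge0 c_refl c_lsc hZclosed lx_cont C0
    coercive growth K0 (ltW hrho).
have upper al v Q : optimal Z c zhat rho lx al v -> ambiguity_set Z c zhat rho Q ->
    (expected_loss Z (loss x) Q <= (objective zhat lx al v)%:E)%E.
  move=> opt [QZ OTQ].
  have [lambda [S [lambda0 hS hV]]] :=
    dual_potential hN hzhat c_refl c_cvx hZconvex lx_ccv hrho opt.
  apply/lee_addgt0Pr => e e0.
  have l1 : 0 < lambda + 1 by rewrite ltr_wpDl.
  have d0 : 0 < e / (lambda + 1) by rewrite divr_gt0.
  have : (OT Z c Q (empirical zhat) < (rho + e / (lambda + 1))%:E)%E.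
    by apply: le_lt_trans OTQ _; rewrite lte_fin ltrDl.
  move=> /ereal_inf_lt[_ [gamma gammaQ <-] /ltW gB].
  have hS' i z : Z z -> lr z <= lambda * c z (zhat i) + S (zhat i).
    by move=> Zz; apply: bigmax_le => [|k _]; exact: hS.
  have :=
    weak_duality hN hzhat c_ge0 c_meas Zmeas lr_meas lambda0 hS' QZ gammaQ gB.
  rewrite /expected_loss lossE => /le_trans; apply.
  rewrite -EFinD lee_fin mulrDr addrAC lerD//.
  by rewrite mulrCA ger_pMr// ler_pdivrMr// mul1r lerDl.
have attain al v : optimal Z c zhat rho lx al v ->
    exists Q : probability (borel_rV R m) R, [/\
      forall A, measurable A -> Q A = program_distribution zhat al v A,
      ambiguity_set Z c zhat rho Q &
      (objective zhat lx al v)%:E = expected_loss Z (loss x) Q].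
  move=> opt; have [feas _] := opt.
  have [Q [QE Qamb intQ]] := feasible_distribution hN hzhat c_meas Zmeas feas.
  exists Q; split => //; apply/eqP; rewrite eq_le upper// andbT.
  rewrite /expected_loss lossE intQ// lee_fin ler_wpM2l ?invr_ge0//.
  apply: ler_sum => i _; apply: ler_sum => k _; rewrite ler_wpM2l//.
  by have [al0 _ _ _] := feas.
have worst al v : optimal Z c zhat rho lx al v ->
    exists Q : probability (borel_rV R m) R,
      (forall A, measurable A -> Q A = program_distribution zhat al v A) /\
      worst_case_distribution Z c zhat rho (loss x) Q.
  move=> opt; have [Q [QE Qamb EQ]] := attain _ _ opt.
  by exists Q; split => //; split => // Q' Q'amb; rewrite -EQ; exact: upper.
have [al2 opt2 card2] := optimal_sparse opt1.
split.
- have [Q1 [_ Q1amb EQ1]] := attain _ _ opt1.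
  transitivity (objective zhat lx al1 v1)%:E.
    apply/eqP; rewrite eq_le; apply/andP; split.
      by apply: ge_ereal_sup => _ [Q Qamb <-]; exact: upper.
    by rewrite EQ1; apply: ereal_sup_ubound; exists Q1.
  apply/eqP; rewrite eq_le; apply/andP; split.
    by apply: ereal_sup_ubound; exists al1, v1; split => //; exact: opt1.1.
  by apply: ge_ereal_sup => _ [al [v [feas ->]]]; rewrite lee_fin; exact: opt1.2.
- exact: worst.
- by exists al2, v1.
- have [Q [QE Qworst]] := worst _ _ opt2.
  set A := [pred ik : 'I_N * 'I_K | al2 ik.1 ik.2 != 0] in card2.
  pose s := [seq zhat ik.1 + v1 ik.1 ik.2 | ik <- enum A].
  exists Q, s; split => //; first by rewrite size_map -cardE.
  have ms : measurable ([set` s] : set (borel_rV R m)).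
    apply: countable_measurable; first exact: measurable_set1_rV.
    exact/finite_set_countable/finite_seq.
  have [[QZ _] _] := Qworst.
  rewrite QE// -(probability_setT Q) QE//; apply: eq_bigr => ik _.
  have [al0|al0] := eqVneq (al2 ik.1 ik.2) 0; first by rewrite al0 mulr0 !mul0e.
  rewrite !diracE in_setT mem_set//=; apply/mapP; exists ik => //.
  by rewrite mem_enum inE.
Qed.
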